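(* For all integers $n \geq 0$, \[a_5(49n+31) \equiv 0 \pmod{7} \quad\text{and}\quad a_9(121n+36) \equiv 0 \pmod{11}.\]
   Context: For a positive integer $d$, $a_d(n)$ denotes the number of partitions of $n$ in which the odd parts are unrestricted and each even part may independently be assigned one of $d$ colors; equivalently $\sum_{n\ge0}a_d(n)q^n = \prod_{k\ge1}\frac{1}{(1-q^k)(1-q^{2k})^{d-1}}$. *)

(* Defs.v *)
From mathcomp Require Import all_boot.

Set Implicit Arguments.
Unset Strict Implicit.
Unset Printing Implicit Defensive.

Definition ncolors (d k : nat) : nat := if odd k then 1 else d.

(* An index k : 'I_n stands for the size k.+1, so these are the coloured parts
   of sizes 1, ..., n, the only ones that can occur in a partition of n. *)
Definition cpart (d n : nat) : finType := {k : 'I_n & 'I_(ncolors d k.+1)}.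

Definition cpart_size (d n : nat) (p : cpart d n) : nat := (tag p).+1.

(* A coloured partition of n is a finite multiset of coloured parts, encoded by
   its multiplicity function; multiplicities are at most n since parts are
   positive. *)
Definition cpartitions (d n : nat) : {set {ffun cpart d n -> 'I_n.+1}} :=
  [set m : {ffun cpart d n -> 'I_n.+1} |
     \sum_(p : cpart d n) m p * cpart_size p == n].

Definition a (d n : nat) : nat := #|cpartitions d n|.

(* Main.v *)
(** Write f_k for the product of the 1 - q^(k m), m >= 1, and let p = 7 or 11 and d = p - 2.
    The generating function of a_d is 1 / (f_1 f_2^(p-3)).  By Gauss, f_2^2 = f_1 psi(q) with
    psi(q) the sum of the q^(k(k+1)/2), so modulo p it equals (1 / f_2)^p * f_2 psi(q), where
    (1 / f_2)^p is a series in q^p.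
    The coefficient of q^j in f_2 psi(q) is a signed count of the solutions of
    3 x^2 + 2 y^2 = 24 j + 5.  If p divides 24 j + 5 exactly once, then multiplication by an
    element of norm p^2 of Q(sqrt(-6)) is a sign-reversing involution on these solutions and the
    coefficient vanishes.  The remaining contributions to a_d(p^2 n + r) all contain a
    coefficient of 1 / f_2 that Ramanujan's partition congruence modulo p annihilates.
    That congruence follows from Jacobi's series for f_2^3: directly for p = 7, and for p = 11 by
    Hirschhorn's argument, in which f_2^12 = f_2 f_2^11 has no terms in five residue classes
    modulo 11; this gives quartic relations between the 11-components of f_2^3 that
    force the required component of (f_2^3)^7 to vanish. *)

Require Import Defs.
From mathcomp Require Import all_boot.
From mathcomp Require Import all_order all_algebra.
From mathcomp Require Import zify ring.

Set Implicit Arguments.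
Unset Strict Implicit.
Unset Printing Implicit Defensive.
Import GRing.Theory.
Local Open Scope ring_scope.

(** * Finite forms of the theta identities *)

Definition tri (n : nat) : nat := (n * n.+1)./2.
Arguments tri : simpl never.

Lemma tri_double n : ((tri n).*2 = n * n.+1)%N.
Proof. by rewrite /tri even_halfK // oddM oddS andbN. Qed.

Lemma triS n : tri n.+1 = (tri n + n.+1)%N.
Proof. by apply: double_inj; rewrite doubleD !tri_double; lia. Qed.

Section FiniteIdentities.
Variables (R : comNzRingType) (q : R).
Implicit Types k m n : nat.

Definition poch (x : R) (m n : nat) : R := \prod_(m <= i < n) (1 - x ^+ i.+1).

Lemma poch_nil x n : poch x n n = 1.
Proof. by rewrite /poch big_geq. Qed.

Lemma pochS x m n : (m <= n)%N -> poch x m n.+1 = poch x m n * (1 - x ^+ n.+1).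
Proof. by move=> le_mn; rewrite /poch big_nat_recr. Qed.

Lemma poch_ltn x m n :
  (m < n)%N -> poch x m n = (1 - x ^+ m.+1) * poch x m.+1 n.
Proof. by move=> lt_mn; rewrite /poch big_ltn. Qed.

(* The Kronecker symbol (12 / y). *)
Definition chi12 (y : nat) : R :=
  if (y %% 12 == 1)%N || (y %% 12 == 11)%N then 1
  else if (y %% 12 == 5)%N || (y %% 12 == 7)%N then - 1 else 0.

Lemma chi12_6n5 n : chi12 (6 * n + 5) = (-1) ^+ n.+1.
Proof.
rewrite -signr_odd /= /chi12; case odd_n: (odd n) => /=; last first.
  have ->: ((6 * n + 5) %% 12 = 5)%N by lia.
  by [].
have ->: ((6 * n + 5) %% 12 = 11)%N by lia.
by [].
Qed.

Lemma chi12_6n7 n : chi12 (6 * n + 7) = (-1) ^+ n.+1.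
Proof.
rewrite -signr_odd /= /chi12; case odd_n: (odd n) => /=; last first.
  have ->: ((6 * n + 7) %% 12 = 7)%N by lia.
  by [].
have ->: ((6 * n + 7) %% 12 = 1)%N by lia.
by [].
Qed.

Lemma chi12_0 n r : r \in [:: 0; 2; 3; 4; 6]%N -> chi12 (6 * n + r) = 0.
Proof.
by rewrite !inE => Hr; rewrite /chi12; case: ifP => H1; [lia|case: ifP => H2 //; lia].
Qed.

(** Euler's series of (-1)^k q^(k(3k+1)/2) over -n <= k <= n, rewritten with y = |6 k + 1|. [chi12]
    supplies the sign and kills the y for which 24 need not divide y^2 - 1. *)
Definition pent_theta n : R := \sum_(y < 6 * n + 2) chi12 y * q ^+ ((y ^ 2 - 1) %/ 24).

Lemma pent_thetaS n : pent_theta n.+1 = pent_theta n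
  + (-1) ^+ n.+1 * (q ^+ (n.+1 ^ 2 + tri n) + q ^+ (n.+1 ^ 2 + tri n.+1)).
Proof.
have T := tri_double n; have T' := tri_double n.+1.
rewrite /pent_theta; have ->: (6 * n.+1 + 2 = (6 * n + 2).+1.+1.+1.+1.+1.+1)%N by lia.
rewrite !big_ord_recr /= -!addnS chi12_6n5 chi12_6n7 (@chi12_0 n 2) // (@chi12_0 n 3) //
  (@chi12_0 n 4) // (@chi12_0 n 6) //.
have -> : ((6 * n + 5) ^ 2 - 1 = (n.+1 ^ 2 + tri n) * 24)%N by nia.
have -> : ((6 * n + 7) ^ 2 - 1 = (n.+1 ^ 2 + tri n.+1) * 24)%N by nia.
by rewrite !mulnK // !mul0r !addr0 -addrA -mulrDr.
Qed.

(** Shanks' finite pentagonal identity: the term s = 0 is the Euler product, and every other term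
    has order above n. *)
Lemma shanks_pentagonal n :
  \sum_(s < n.+1) (-1) ^+ s * poch q s n * q ^+ (s * n + tri s) = pent_theta n.
Proof.
elim: n => [|n IHn].
  by rewrite big_ord1 /= poch_nil /pent_theta !big_ord_recr big_ord0 /= /chi12 /=;
    rewrite !mul1r mul0r !add0r.
(* Passing from n to n + 1 in a partial sum telescopes to one boundary term. At m = n it is the
   first new theta term; the summand s = n + 1 is the second. *)
have partial m : (m <= n)%N ->
    \sum_(s < m.+1) (-1) ^+ s * poch q s n.+1 * q ^+ (s * n.+1 + tri s)
    = \sum_(s < m.+1) (-1) ^+ s * poch q s n * q ^+ (s * n + tri s)
      + (-1) ^+ m.+1 * poch q m n * q ^+ (m.+1 * n.+1 + tri m).
  elim: m => [_|m IHm lt_mn].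
    rewrite !big_ord1 /= pochS // !mul0n !mul1n !add0n addn0 !expr0; ring.
  rewrite big_ord_recr IHm /=; last exact: ltnW.
  rewrite [X in _ = X + _]big_ord_recr /= pochS // (@poch_ltn _ m) //.
  rewrite !triS !mulSn !mulnS !exprD !exprS; ring.
rewrite big_ord_recr /= partial // IHn pent_thetaS !poch_nil -mulnn !exprD !exprS; ring.
Qed.

Definition odd_poch n : R := \prod_(i < n) (1 - q ^+ i.*2.+1).

Lemma odd_pochS n : odd_poch n.+1 = odd_poch n * (1 - q ^+ n.*2.+1).
Proof. by rewrite /odd_poch big_ord_recr. Qed.

Lemma poch_odd_even n :
  poch q 0 n.*2 = odd_poch n * poch (q ^+ 2) 0 n.
Proof.
elim: n => [|n IHn]; first by rewrite /odd_poch big_ord0 !poch_nil mulr1.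
rewrite doubleS !pochS // IHn odd_pochS -exprM -[(2 * _)%N]/(2 * n.+1)%N mul2n doubleS; ring.
Qed.

Definition tri_theta n : R := \sum_(x < 4 * n + 2 | odd x) q ^+ ((x ^ 2 - 1) %/ 8).

Lemma tri_thetaS n : tri_theta n.+1 =
  tri_theta n + q ^+ (n.+1 * n.*2.+1) + q ^+ (n.+1 * n.*2.+3).
Proof.
rewrite /tri_theta !(big_mkcond (fun x => odd (nat_of_ord x))) /=.
have -> : (4 * n.+1 + 2 = (4 * n + 2).+4)%N by lia.
have odd_N : odd (4 * n + 2) = false by lia.
have e3 : ((4 * n + 2).+1 ^ 2 - 1 = n.+1 * n.*2.+1 * 8)%N by nia.
have e5 : ((4 * n + 2).+3 ^ 2 - 1 = n.+1 * n.*2.+3 * 8)%N by nia.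
move: (4 * n + 2)%N odd_N e3 e5 => N odd_N e3 e5.
by rewrite !big_ord_recr /= odd_N /= e3 e5 !mulnK // !addr0.
Qed.

(** Shanks' finite form of Gauss's identity, by the same telescoping up to the factor 1 -
    q^(2n+1). *)
Lemma shanks_gauss n :
  \sum_(s < n.+1) poch (q ^+ 2) s n * odd_poch s * q ^+ (s * n.*2.+1)
  = odd_poch n * tri_theta n.
Proof.
elim: n => [|n IHn].
  rewrite big_ord1 /= poch_nil /tri_theta !(big_mkcond (fun x => odd (nat_of_ord x))) /=.
  by rewrite /odd_poch muln0 add0n !big_ord_recr !big_ord0 /= !mul1r !add0r.
have partial m : (m <= n)%N ->
    \sum_(s < m.+1) poch (q ^+ 2) s n.+1 * odd_poch s * q ^+ (s * n.+1.*2.+1)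
    = (1 - q ^+ n.*2.+1) *
        (\sum_(s < m.+1) poch (q ^+ 2) s n * odd_poch s * q ^+ (s * n.*2.+1))
      + poch (q ^+ 2) m n * odd_poch m.+1 * q ^+ (m.+1 * n.*2.+1).
  elim: m => [_|m IHm lt_mn].
    rewrite !big_ord1 /= pochS // odd_pochS /odd_poch big_ord0 !mul0n mul1n !expr0.
    rewrite -exprM mul2n doubleS !exprS; ring.
  rewrite big_ord_recr IHm /=; last exact: ltnW.
  rewrite [X in _ = _ * X + _]big_ord_recr /= pochS // (@poch_ltn _ m) // !odd_pochS.
  rewrite -!exprM !mul2n !doubleS !mulSn !mulnS -!addnn ?exprD ?exprS ?exprD; ring.
rewrite big_ord_recr /= partial // IHn tri_thetaS !poch_nil odd_pochS doubleS; ring.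
Qed.

(* The Gaussian binomial [2n+1 choose n-k]: up to the factor (-1)^k q^(k(k+1)/2) it is the
   coefficient of z^-k in (1 - z) * prod_(1 <= i <= n) (1 - z q^i)(1 - q^i / z), and the
   recursion is multiplication by the factor of index n+1. *)
Fixpoint cbin n k : R :=
  match n, k with
  | 0, _ => (k == 0)%:R
  | n.+1, 0 => (1 + q ^+ n.*2.+2 + q ^+ n.+1) * cbin n 0 + q ^+ n.+2 * cbin n 1
  | n.+1, k.+1 => (1 + q ^+ n.*2.+2) * cbin n k.+1 + q ^+ (n - k) * cbin n k
                  + q ^+ (n + k).+3 * cbin n k.+2
  end.

Lemma cbin_gt n k : (n < k)%N -> cbin n k = 0.
Proof.
elim: n k => [|n IHn] [|k] //= lt_nk.
by rewrite !IHn ?mulr0 ?addr0 //; lia.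
Qed.

Lemma cbin_diag n : cbin n n = 1.
Proof.
elim: n => //= n ->; rewrite !cbin_gt // subnn expr0; ring.
Qed.

(* The derivative of that product at z = 1. *)
Lemma sum_cbin n :
  \sum_(k < n.+1) (-1) ^+ k * k.*2.+1%:R * q ^+ tri k * cbin n k = poch q 0 n ^+ 2.
Proof.
pose c n k := (-1) ^+ k * q ^+ tri k * cbin n k.
have c_gt m k : (m < k)%N -> c m k = 0 by move=> lt_mk; rewrite /c cbin_gt ?mulr0.
suff S n' : \sum_(k < n'.+1) k.*2.+1%:R * c n' k = poch q 0 n' ^+ 2.
  by rewrite -S; apply: eq_bigr => k _; rewrite /c; ring.
elim: n' => [|m IHm].
  by rewrite big_ord1 poch_nil /c /= !mul1r !expr1n.
have partial j : \sum_(k < j.+1) k.*2.+1%:R * c m.+1 k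
    = (1 - q ^+ m.+1) ^+ 2 * (\sum_(k < j.+1) k.*2.+1%:R * c m k)
      - q ^+ m.+1 * (j.*2.+1%:R * c m j.+1 - j.*2.+3%:R * c m j).
  elim: j => [|j IHj].
    rewrite !big_ord1 /c /= -!addnn ?exprS ?exprD; ring.
  rewrite big_ord_recr IHj [in RHS]big_ord_recr /=.
  have E : q ^+ (m - j) * q ^+ tri j.+1 * cbin m j = q ^+ m.+1 * q ^+ tri j * cbin m j.
    have [le_jm|lt_mj] := leqP j m; last by rewrite cbin_gt ?mulr0.
    by rewrite -!exprD triS; congr (_ ^+ _ * _); lia.
  (* The sign and the power of q in [c] make the recursion of [cbin] symmetric in the two
     neighbours, so the weighted sums telescope. *)
  have -> : c m.+1 j.+1 = (1 + q ^+ m.*2.+2) * c m j.+1 - q ^+ m.+1 * (c m j + c m j.+2).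
    rewrite /c /= 2!mulrDr.
    rewrite [X in _ + X + _ = _](_ : _ = (-1) ^+ j.+1 * (q ^+ (m - j) * q ^+ tri j.+1 * cbin m j));
      last by ring.
    rewrite E (triS j.+1) !exprD -!addnS exprD !exprS; ring.
  rewrite -!addnn !exprS !exprD; ring.
rewrite partial big_ord_recr /= IHm !c_gt // !mulr0 subr0 addr0 mulr0 subr0.
by rewrite pochS // exprMn mulrC.
Qed.

Lemma cbin_poch n k : (k <= n)%N ->
  cbin n k * poch q 0 (n - k) * poch q 0 (n + k).+1 = poch q 0 n.*2.+1.
Proof.
elim: n k => [|n IHn] k; first by case: k => //= _; rewrite !mul1r poch_nil mul1r.
(* The induction hypothesis at j + 1, multiplied out so that it also covers j = n, where both sides
   vanish. *)
have step j : (j <= n)%N -> cbin n j.+1 * poch q 0 (n - j).+1 * poch q 0 (n + j).+2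
    = (1 - q ^+ (n - j)) * (1 - q ^+ (n - j).+1) * poch q 0 n.*2.+1.
  rewrite leq_eqVlt => /predU1P[->|lt_jn].
    by rewrite cbin_gt // subnn expr0 subrr !mul0r.
  have -> : (n - j = (n - j.+1).+1)%N by lia.
  by rewrite -(IHn _ lt_jn) addnS !pochS //; ring.
rewrite leq_eqVlt => /predU1P[->|].
  by rewrite cbin_diag subnn poch_nil !mul1r addnn doubleS.
case: k => [_|k lt_kn].
  have E0 := IHn 0%N isT; have E1 := step 0%N isT.
  rewrite subn0 addn0 in E0 E1 *.
  transitivity ((1 + q ^+ n.*2.+2 + q ^+ n.+1) * (cbin n 0 * poch q 0 n * poch q 0 n.+1)
      * (1 - q ^+ n.+1) * (1 - q ^+ n.+2)
      + q ^+ n.+2 * (cbin n 1 * poch q 0 n.+1 * poch q 0 n.+2)).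
    by rewrite /= addn0 (pochS _ (leq0n n)) (pochS _ (leq0n n.+1)) (pochS _ (leq0n n)); ring.
  rewrite E0 E1 doubleS !pochS // -!addnn ?exprS ?exprD; ring.
have le_kn : (k <= n)%N by lia.
have E0 := IHn k le_kn; have E1 := IHn k.+1 lt_kn; have E2 := step k.+1 lt_kn.
rewrite subSS; move Ej : (n - k.+1)%N E1 E2 => j E1 E2.
have Ej1 : (n - k = j.+1)%N by lia.
rewrite Ej1 in E0 *; rewrite addnS in E1 E2; rewrite addSn addnS.
move Ei : (n + k).+1 E0 E1 E2 => i E0 E1 E2.
transitivity ((1 + q ^+ n.*2.+2) * (cbin n k.+1 * poch q 0 j * poch q 0 i.+1)
    * (1 - q ^+ j.+1) * (1 - q ^+ i.+2)
    + q ^+ j.+1 * (cbin n k * poch q 0 j.+1 * poch q 0 i) * (1 - q ^+ i.+1) * (1 - q ^+ i.+2)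
    + q ^+ i.+2 * (cbin n k.+2 * poch q 0 j.+1 * poch q 0 i.+2)).
  rewrite /= Ej1 Ei (pochS _ (leq0n i.+1)) (pochS _ (leq0n i)) (pochS _ (leq0n j)); ring.
have En : (n.*2.+2 = j + i.+1 + 1)%N by lia.
rewrite E0 E1 E2 doubleS !pochS // En !exprS exprD exprD ?exprS; ring.
Qed.
End FiniteIdentities.

Lemma chi12_neq0 (A : comNzRingType) (y : nat) : chi12 A y != 0 -> exists e, (y ^ 2 = 24 * e + 1)%N.
Proof.
rewrite /chi12 => chi_neq0; exists ((y ^ 2 - 1) %/ 24)%N.
have [k [c [-> Hc]]] : exists k c, y = (12 * k + c)%N /\ c \in [:: 1; 5; 7; 11]%N.
  exists (y %/ 12)%N, (y %% 12)%N; split; first by lia.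
  move: chi_neq0; rewrite !inE; case: ifP => [/orP[]-> _|_]; rewrite ?orbT //.
  by case: ifP => [/orP[]-> _|_]; rewrite ?orbT ?eqxx.
move: Hc; rewrite !inE => /or4P[] /eqP ->; lia.
Qed.

(** * Polynomials modulo a power of the indeterminate *)

Section Truncation.
Variable R : comNzRingType.
Implicit Types (p q g h : {poly R}) (N : nat).

Definition eqX N p q := forall i, (i < N)%N -> p`_i = q`_i.

Lemma eqX_sym N p q : eqX N p q -> eqX N q p.
Proof. by move=> pq i lt_iN; rewrite pq. Qed.

Lemma eqX_trans N p q g : eqX N p q -> eqX N q g -> eqX N p g.
Proof. by move=> pq qg i lt_iN; rewrite pq ?qg. Qed.

Lemma eqX_add N p p' q q' : eqX N p p' -> eqX N q q' -> eqX N (p + q) (p' + q').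
Proof. by move=> pp' qq' i lt_iN; rewrite !coefD pp' ?qq'. Qed.

Lemma eqX_mul N p p' q q' : eqX N p p' -> eqX N q q' -> eqX N (p * q) (p' * q').
Proof.
move=> pp' qq' i lt_iN; rewrite !coefM; apply: eq_bigr => j _.
have lt_ji := ltn_ord j; rewrite pp' ?qq' //; lia.
Qed.

Lemma eqX_exp N k p p' : eqX N p p' -> eqX N (p ^+ k) (p' ^+ k).
Proof.
move=> pp'; elim: k => [|k IHk]; first by rewrite !expr0.
by rewrite !exprS; apply: eqX_mul.
Qed.

Lemma eqX_sum N (I : Type) (r : seq I) (P : pred I) (F G : I -> {poly R}) :
  (forall i, P i -> eqX N (F i) (G i)) ->
  eqX N (\sum_(i <- r | P i) F i) (\sum_(i <- r | P i) G i).
Proof.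
by move=> FG; elim/big_rec2: _ => [//|i p q Pi pq]; apply: eqX_add => //; apply: FG.
Qed.

Lemma eqX_sum0 N (I : Type) (r : seq I) (P : pred I) (F : I -> {poly R}) :
  (forall i, P i -> eqX N (F i) 0) -> eqX N (\sum_(i <- r | P i) F i) 0.
Proof.
by move=> F0; have := eqX_sum r F0; rewrite [X in eqX _ _ X]big1.
Qed.

Lemma eqX_prod N (I : Type) (r : seq I) (P : pred I) (F G : I -> {poly R}) :
  (forall i, P i -> eqX N (F i) (G i)) ->
  eqX N (\prod_(i <- r | P i) F i) (\prod_(i <- r | P i) G i).
Proof.
by move=> FG; elim/big_rec2: _ => [//|i p q Pi pq]; apply: eqX_mul => //; apply: FG.
Qed.

Lemma eqX_mulXn N M k p q :
  (N <= M + k)%N -> eqX M p q -> eqX N (p * 'X^k) (q * 'X^k).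
Proof.
by move=> le_N pq i lt_iN; rewrite !coefMXn; case: ltnP => // le_ki; apply: pq; lia.
Qed.

Lemma eqX_mulXn0 N k p : (N <= k)%N -> eqX N (p * 'X^k) 0.
Proof. by move=> le_Nk i lt_iN; rewrite coefMXn coef0 (leq_trans lt_iN). Qed.

Lemma eqX_1subXn N k p : (N <= k)%N -> eqX N (p * (1 - 'X^k)) p.
Proof.
by move=> le_Nk i lt_iN; rewrite mulrBr mulr1 coefB (eqX_mulXn0 _ le_Nk) // coef0 subr0.
Qed.

Lemma eqX_expr0 p k : p`_0 = 0 -> eqX k (p ^+ k) 0.
Proof.
move=> p0; elim: k => // k IHk i lt_ik; rewrite exprS coefM coef0 big1 // => -[[|j] /= lt_ji] _.
  by rewrite p0 mul0r.
by rewrite IHk ?coef0 ?mulr0 //; lia.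
Qed.

(** The inverse is a truncated geometric series in 1 - g; its error (1 - g)^N is divisible by
    X^N. *)
Lemma eqX_inv N g : g`_0 = 1 -> exists h, eqX N (g * h) 1.
Proof.
move=> g0; exists (\sum_(i < N) (1 - g) ^+ i) => i lt_iN.
have -> : g * (\sum_(i < N) (1 - g) ^+ i) = 1 - (1 - g) ^+ N.
  have := subrX1 (1 - g) N; rewrite (_ : 1 - g - 1 = - g); last by ring.
  by move=> E; apply: oppr_inj; rewrite opprB E mulNr.
by rewrite coefB (@eqX_expr0 (1 - g) N) ?coef0 ?subr0 // coefB coef1 g0 subrr.
Qed.

Lemma eqX_cancel N g p q : g`_0 = 1 -> eqX N (g * p) (g * q) -> eqX N p q.
Proof.
move=> /(@eqX_inv N)[h gh] gpq.
have hg u : eqX N u (h * (g * u)).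
  by rewrite mulrA [h * g]mulrC -{1}[u]mul1r; apply: eqX_mul => //; apply: eqX_sym.
by apply: eqX_trans (hg p) (eqX_trans _ (eqX_sym (hg q))); apply: eqX_mul.
Qed.

End Truncation.

(** * Theta series of Euler, Gauss and Jacobi *)

Section EulerProducts.
Variable R : comNzRingType.
Local Notation f2 n := (poch ('X^2 : {poly R}) 0 n).

Lemma poch_eqX m n : (m <= n)%N -> eqX m.+1 (f2 n) (f2 m).
Proof.
elim: n => [|n IHn]; first by rewrite leqn0 => /eqP ->.
rewrite leq_eqVlt => /predU1P[-> //|lt_mn].
rewrite pochS // -exprM; apply: eqX_trans (IHn _) => //; apply: eqX_1subXn; lia.
Qed.

Lemma poch_coef0 n : (f2 n)`_0 = 1.
Proof. by rewrite (poch_eqX (leq0n n)) // poch_nil coef1. Qed.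

Lemma eqX_pent n : eqX n.+1 (f2 n) (pent_theta 'X^2 n).
Proof.
rewrite -shanks_pentagonal big_ord_recl /= mul0n expr0 mul1r expr0 mulr1.
rewrite -[X in eqX _ X _]addr0; apply: eqX_add => //; apply: eqX_sym.
apply: eqX_sum0 => i _; rewrite -exprM; apply: eqX_mulXn0.
by rewrite /bump /= add1n triS mulSn; lia.
Qed.

(** Multiplying [shanks_gauss] by [f2 n] completes the odd factors to f_1; the summands with s >= 1
    have order above 2 n. *)
Lemma eqX_gauss n :
  eqX n.+1 (poch 'X 0 n.*2 * tri_theta 'X n) (f2 n ^+ 2).
Proof.
rewrite poch_odd_even -mulrA mulrCA mulrA -mulrA -shanks_gauss big_ord_recl /=.
rewrite mul0n expr0 mulr1 /odd_poch big_ord0 mulr1 expr2; apply: eqX_mul => //.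
rewrite -[X in eqX _ _ X]addr0; apply: eqX_add => //.
apply: eqX_sum0 => i _; apply: eqX_mulXn0; rewrite /bump /= add1n mulSn; lia.
Qed.

Definition jac_theta n : {poly R} :=
  \sum_(k < n.+1) (-1) ^+ k * k.*2.+1%:R * 'X^(k * k.+1).

(** In [cbin_poch] all four Euler products agree to this precision, so one of them can be
    cancelled. *)
Lemma cbin_eqX n k : (k <= n)%N -> eqX (n - k).+1 (cbin 'X^2 n k * f2 n) 1.
Proof.
move=> le_kn; apply: (@eqX_cancel _ _ (f2 (n - k))); first exact: poch_coef0.
have E m : (n - k <= m)%N -> eqX (n - k).+1 (f2 m) (f2 (n - k)) by apply: poch_eqX.
apply: (@eqX_trans _ _ _ (f2 (n - k) * (cbin 'X^2 n k * f2 (n + k).+1))).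
  do 2!apply: eqX_mul => //.
  by apply: eqX_trans (E n _) (eqX_sym (E (n + k).+1 _)); lia.
rewrite mulr1 mulrA [f2 (n - k) * _]mulrC cbin_poch //; apply: E; lia.
Qed.

(** One more factor [f2 n] turns each Gaussian binomial of [sum_cbin] into 1; the k orders of
    precision lost in [cbin_eqX] are regained from X^(k(k+1)). *)
Lemma eqX_jacobi n : eqX n.+1 (f2 n ^+ 3) (jac_theta n).
Proof.
rewrite exprSr -sum_cbin mulr_suml; apply: eqX_sum => -[k /= le_kn] _.
rewrite -exprM mul2n tri_double.
rewrite -[X in eqX _ _ X]mul1r (_ : _ * f2 n =
  cbin 'X^2 n k * f2 n * ((-1) ^+ k * k.*2.+1%:R) * 'X^(k * k.+1)); last by ring.
rewrite mulrA; apply: (@eqX_mulXn _ _ (n - k).+1); first by nia.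
by apply: eqX_mul => //; apply: cbin_eqX.
Qed.
End EulerProducts.

(** * Components modulo m *)

Section Dissection.
Variables (R : comNzRingType) (m : nat).
Hypothesis m_gt0 : (0 < m)%N.
Implicit Types (p q : {poly R}) (r s N : nat).

Definition dissect r p : {poly R} := \poly_(i < size p) (if (i %% m == r)%N then p`_i else 0).

Lemma coef_dissect r p i : (dissect r p)`_i = if (i %% m == r)%N then p`_i else 0.
Proof.
rewrite coef_poly; case: ltnP => // le_pi; rewrite nth_default //.
by case: ifP.
Qed.

Lemma eqX_dissect N r p q : eqX N p q -> eqX N (dissect r p) (dissect r q).
Proof. by move=> pq i lt_iN; rewrite !coef_dissect pq. Qed.

Lemma dissect_eq0 r p : (forall i, (i %% m = r)%N -> p`_i = 0) -> dissect r p = 0.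
Proof.
by move=> p0; apply/polyP => i; rewrite coef_dissect coef0; case: eqP => // /p0.
Qed.

Lemma dissectM r p q : (r < m)%N ->
  dissect r (p * q) = \sum_(s < m) dissect s p * dissect ((r + m - s) %% m) q.
Proof.
move=> lt_rm; apply/polyP => i; rewrite coef_dissect coef_sum.
under eq_bigr do rewrite coefM.
rewrite exchange_big /= coefM.
transitivity (\sum_(j < i.+1) if (i %% m == r)%N then p`_j * q`_(i - j) else 0).
  by case: ifP => // _; rewrite big1.
apply: eq_bigr => j _.
rewrite (bigD1 (Ordinal (ltn_pmod j m_gt0))) //= big1 => [|s neq_s]; last first.
  rewrite coef_dissect; case: eqP => [js|]; last by rewrite mul0r.
  by case/eqP: neq_s; apply: val_inj.
rewrite !coef_dissect eqxx addr0.
have lt_ji : (j <= i)%N by rewrite -ltnS.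
have -> : ((i - j) %% m == (r + m - j %% m) %% m)%N = (i %% m == r)%N.
  rewrite -(eqn_modDr (j %% m)) subnK; last first.
    by apply: leq_trans (leq_addl _ _); apply/ltnW/ltn_pmod.
  by rewrite modnDmr subnK // modnDr (modn_small lt_rm).
by case: ifP; rewrite ?mulr0.
Qed.

End Dissection.

(** * Components in characteristic p *)

Section Frobenius.
Variables (R : comNzRingType) (p : nat).
Hypothesis charRp : p \in [pchar R].
Implicit Types (P Q : {poly R}).

Let p_gt0 : (0 < p)%N.
Proof. by rewrite prime_gt0 // (pcharf_prime charRp). Qed.

Lemma coef_Frobenius P i : (P ^+ p)`_i = if (p %| i)%N then P`_(i %/ p) ^+ p else 0.
Proof.
have charP : p \in [pchar {poly R}] by rewrite pchar_poly.
rewrite -(pFrobenius_autE charP) -{1}[P]coefK poly_def raddf_sum coef_sum /=.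
under eq_bigr => j _.
  rewrite pFrobenius_autE exprZn -exprM coefZ coefXn. over.
have [/dvdnP[k ->]|ndvd] := ifP; last first.
  rewrite big1 // => j _; case: eqP => [ij|]; last by rewrite mulr0.
  by rewrite ij dvdn_mull in ndvd.
rewrite mulnK //; have [lt_kP|le_Pk] := ltnP k (size P); last first.
  rewrite nth_default // expr0n -[p == 0]/(p == 0)%N gtn_eqF // big1 // => j _.
  rewrite eqn_pmul2r // gtn_eqF ?mulr0 //.
  exact: leq_trans (ltn_ord j) le_Pk.
rewrite (bigD1 (Ordinal lt_kP)) //= eqxx mulr1 big1 ?addr0 // => j neq_jk.
rewrite eqn_pmul2r // eq_sym; case: eqP => [jk|]; last by rewrite mulr0.
by case/eqP: neq_jk; apply: val_inj.
Qed.

(** All exponents of P^p are multiples of p, so P^p acts on components like a scalar. *)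
Lemma dissect_Frobenius r P Q : (r < p)%N ->
  dissect p r (P ^+ p * Q) = P ^+ p * dissect p r Q.
Proof.
move=> lt_rp; rewrite dissectM // (bigD1 (Ordinal p_gt0)) //= big1 => [|s neq_s0].
  rewrite subn0 modnDr modn_small // addr0; congr (_ * _).
  apply/polyP => i; rewrite coef_dissect; case: ifPn => // ndvd.
  by rewrite coef_Frobenius /dvdn (negPf ndvd).
rewrite dissect_eq0 ?mul0r // => i Ei; rewrite coef_Frobenius /dvdn Ei.
by case: eqP => // s0; case/eqP: neq_s0; apply: val_inj.
Qed.

Lemma dissect_jac r n :
  all (fun c => (c * c.+1 %% p == r) ==> (p %| c.*2.+1))%N (iota 0 p) ->
  dissect p r (jac_theta R n) = 0.
Proof.
move=> /allP check.
have {check} Hr k : (k * k.+1 %% p = r -> p %| k.*2.+1)%N.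
  move=> kr; have := check (k %% p)%N; rewrite mem_iota ltn_pmod // => /(_ isT).
  rewrite -addn1 modnMml -modnMmr modnDml modnMmr addn1 kr eqxx /= => dvd_p.
  by rewrite /dvdn -addn1 -muln2 -modnDml -modnMml modnDml addn1 muln2.
apply: dissect_eq0 => i Ei; rewrite coef_sum big1 // => k _.
rewrite coefMXn; case: ltnP => // le_ki.
have -> : (-1) ^+ k * k.*2.+1%:R = ((-1) ^+ k * k.*2.+1%:R)%:P :> {poly R}.
  by rewrite polyCM polyC_exp polyCN polyC_natr.
rewrite coefC subn_eq0; case: leqP => // le_ik.
have ik : i = (k * k.+1)%N by apply/eqP; rewrite eqn_leq le_ik.
have := Hr k; rewrite -ik => /(_ Ei); rewrite (dvdn_pcharf charRp) => /eqP ->.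
by rewrite mulr0.
Qed.

Lemma dissect_pent r n : (forall y e, y ^ 2 = 24 * e + 1 -> (2 * e) %% p <> r)%N ->
  dissect p r (pent_theta 'X^2 n : {poly R}) = 0.
Proof.
move=> Hr; apply: dissect_eq0 => i Ei; rewrite coef_sum big1 // => y _.
have [->|/chi12_neq0[e ye]] := eqVneq (chi12 {poly R} y) 0; first by rewrite mul0r coef0.
rewrite ye addnK mulKn // -exprM.
have /negPf neq_ie : i != (2 * e)%N by apply/eqP => ie; case: (Hr _ _ ye); rewrite -ie.
rewrite /chi12; case: ifP => _; first by rewrite mul1r coefXn neq_ie.
by case: ifP => _; rewrite ?mul0r ?coef0 // mulN1r coefN coefXn neq_ie oppr0.
Qed.

End Frobenius.

Ltac eval_modn :=
  repeat match goal with |- context [modn ?a ?b] =>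
    let v := eval vm_compute in (modn a b) in progress change (modn a b) with v end.

(** * Ramanujan's congruences for 1 / f_2 *)

Section Ramanujan.
Variable R : comNzRingType.
Local Notation f2 n := (poch ('X^2 : {poly R}) 0 n).

(** Here h = h^7 (f_2^3)^2. The series of f_2^3 lives in the classes 0, 2, 6 modulo 7, no two of
    which add up to 3. The class 3 contains 2 (7 k + 5), since f_2 is a product in q^2. *)
Lemma ramanujan7 n (h : {poly R}) : 7 \in [pchar R] ->
  eqX n.+1 (f2 n * h) 1 -> eqX n.+1 (dissect 7 3 h) 0.
Proof.
move=> char7 fh.
set J := jac_theta R n.
have J0 r : (r \in [:: 1; 3; 4; 5])%N -> dissect 7 r J = 0.
  by rewrite !inE => /or4P[] /eqP ->; apply: dissect_jac.
have eq_h : eqX n.+1 h (h ^+ 7 * (J * J)).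
  apply: (@eqX_trans _ _ _ (h * (f2 n * h) ^+ 6)).
    rewrite -{1}[h]mulr1 -(expr1n _ 6); apply/eqX_mul/eqX_exp/eqX_sym => //.
  rewrite (_ : h * _ = h ^+ 7 * (f2 n ^+ 3 * f2 n ^+ 3)); last by ring.
  by do 2!apply: eqX_mul => //; apply: eqX_jacobi.
apply: eqX_trans; first exact: eqX_dissect eq_h.
rewrite dissect_Frobenius // dissectM // !big_ord_recl big_ord0 /=.
eval_modn.
by rewrite (J0 1%N) // (J0 3%N) // (J0 4%N) // (J0 5%N) // !(mul0r, mulr0, addr0).
Qed.

Lemma dissect11M r (p q : {poly R}) : (r < 11)%N -> dissect 11 r (p * q) =
    dissect 11 0 p * dissect 11 ((r + 11 - 0) %% 11) q +
    dissect 11 1 p * dissect 11 ((r + 11 - 1) %% 11) q +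
    dissect 11 2 p * dissect 11 ((r + 11 - 2) %% 11) q +
    dissect 11 3 p * dissect 11 ((r + 11 - 3) %% 11) q +
    dissect 11 4 p * dissect 11 ((r + 11 - 4) %% 11) q +
    dissect 11 5 p * dissect 11 ((r + 11 - 5) %% 11) q +
    dissect 11 6 p * dissect 11 ((r + 11 - 6) %% 11) q +
    dissect 11 7 p * dissect 11 ((r + 11 - 7) %% 11) q +
    dissect 11 8 p * dissect 11 ((r + 11 - 8) %% 11) q +
    dissect 11 9 p * dissect 11 ((r + 11 - 9) %% 11) q +
    dissect 11 10 p * dissect 11 ((r + 11 - 10) %% 11) q.
Proof.
by move=> lt_r; rewrite dissectM // !big_ord_recl big_ord0 /= addr0 !addrA.
Qed.

Section Eleven.
Variable J : {poly R}.
Hypothesis J0 : forall r, r \in [:: 3; 4; 5; 7; 8; 10]%N -> dissect 11 r J = 0.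
Local Notation a0 := (dissect 11 0 J).
Local Notation a1 := (dissect 11 1 J).
Local Notation a2 := (dissect 11 2 J).
Local Notation a6 := (dissect 11 6 J).
Local Notation a9 := (dissect 11 9 J).

Lemma dissect_square r : (r < 11)%N -> dissect 11 r (J * J) =
  nth 0 [:: a0 ^+ 2 + 2 * a2 * a9;
    2 * a0 * a1 + a6 ^+ 2;
    2 * a0 * a2 + a1 ^+ 2;
    2 * a1 * a2;
    a2 ^+ 2 + 2 * a6 * a9;
    0;
    2 * a0 * a6;
    2 * a1 * a6 + a9 ^+ 2;
    2 * a2 * a6;
    2 * a0 * a9;
    2 * a1 * a9] r.
Proof.
by do 11?[case: r => [|r]] => // _; rewrite dissectM // !big_ord_recl big_ord0 /=; eval_modn;
  rewrite (@J0 3) // (@J0 4) // (@J0 5) // (@J0 7) // (@J0 8) // (@J0 10) //; ring.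
Qed.

(* The left side lies in the ideal that the quartic components generate modulo 11; the cubic
   cofactors and the multiple 11 * W come from solving the linear system by computer. *)
Lemma dissect_seventh : 11 \in [pchar R] ->
  dissect 11 1 (J * J * (J * J) * (J * J * J)) =
    (- a0 ^+ 3 - a0 * a2 * a9 + 4 * a1 ^+ 2 * a9) * dissect 11 1 (J * J * (J * J))
    + (- a0 * a1 * a6 + 4 * a0 * a9 ^+ 2 - a6 ^+ 3) * dissect 11 5 (J * J * (J * J))
    + (4 * a0 ^+ 2 * a6 - a2 ^+ 3 - a2 * a6 * a9) * dissect 11 6 (J * J * (J * J))
    + (4 * a1 * a2 ^+ 2 - a1 * a6 * a9 - a9 ^+ 3) * dissect 11 7 (J * J * (J * J))
    + (- a0 * a1 * a2 - a1 ^+ 3 + 4 * a2 * a6 ^+ 2) * dissect 11 9 (J * J * (J * J)).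
Proof.
move=> char11.
have eleven0 : 11%:R = 0 :> {poly R} by apply: pcharf0; rewrite pchar_poly.
set W := a0 ^+ 6 * a1 + a0 ^+ 5 * a6 ^+ 2 + 22 * a0 ^+ 4 * a1 * a2 * a9 + 12 * a0 ^+ 3 * a1 ^+
      3 * a9 + 12 * a0 ^+ 3 * a2 ^+ 3 * a6 + 30 * a0 ^+ 3 * a2 * a6 ^+ 2 * a9 + 54 * a0 ^+
      2 * a1 ^+ 2 * a2 ^+ 2 * a6 + 54 * a0 ^+ 2 * a1 ^+ 2 * a6 ^+ 2 * a9 + 54 * a0 ^+ 2 *
      a1 * a2 ^+ 2 * a9 ^+ 2 + 30 * a0 ^+ 2 * a1 * a6 * a9 ^+ 3 + a0 ^+ 2 * a9 ^+ 5 + 22 *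
      a0 * a1 ^+ 4 * a2 * a6 + 30 * a0 * a1 ^+ 3 * a2 * a9 ^+ 2 + 30 * a0 * a1 * a2 ^+ 2 *
      a6 ^+ 3 + 22 * a0 * a1 * a6 ^+ 4 * a9 + a0 * a2 ^+ 6 + 22 * a0 * a2 ^+ 4 * a6 * a9 +
      54 * a0 * a2 ^+ 2 * a6 ^+ 2 * a9 ^+ 2 + 12 * a0 * a6 ^+ 3 * a9 ^+ 3 + a1 ^+ 6 * a6 +
      a1 ^+ 5 * a9 ^+ 2 + 12 * a1 ^+ 3 * a2 * a6 ^+ 3 + a1 ^+ 2 * a2 ^+ 5 + 30 * a1 ^+ 2 *
      a2 ^+ 3 * a6 * a9 + 54 * a1 ^+ 2 * a2 * a6 ^+ 2 * a9 ^+ 2 + 12 * a1 * a2 ^+ 3 * a9 ^+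
      3 + 22 * a1 * a2 * a6 * a9 ^+ 4 + a2 ^+ 2 * a6 ^+ 5 + a2 * a9 ^+ 6 + a6 ^+ 6 * a9.
(* Adding 11 W = 0 on the right gives an identity over the integers, within reach of [ring]. *)
rewrite -[RHS]addr0 -(mul0r W) -eleven0 {}/W.
rewrite (@dissect11M 1 (J * J * (J * J))) //; eval_modn.
rewrite !(@dissect11M _ (J * J)) //. eval_modn.
rewrite !dissect_square //=.
rewrite (@J0 3) // (@J0 4) // (@J0 5) // (@J0 7) // (@J0 8) // (@J0 10) //.
ring.
Qed.
End Eleven.

(** Here h = (h^2)^11 (f_2^3)^7, and [dissect_seventh] reduces the claim to vanishing components of
    f_2^12. *)
Lemma ramanujan11 n (h : {poly R}) : 11 \in [pchar R] ->
  eqX n.+1 (f2 n * h) 1 -> eqX n.+1 (dissect 11 1 h) 0.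
Proof.
move=> char11 fh; set J := jac_theta R n.
have J0 r : (r \in [:: 3; 4; 5; 7; 8; 10])%N -> dissect 11 r J = 0.
  by move=> Hr; apply: dissect_jac => //; move: r Hr; apply/allP.
have fJ : eqX n.+1 (f2 n ^+ 3) J by apply: eqX_jacobi.
have J4 r : (r \in [:: 1; 5; 6; 7; 9])%N -> eqX n.+1 (dissect 11 r (J * J * (J * J))) 0.
  move=> Hr; have lt_r : (r < 11)%N by move: Hr; rewrite !inE; lia.
  have eqJ4 : eqX n.+1 (J * J * (J * J)) (f2 n ^+ 11 * pent_theta 'X^2 n).
    apply: (@eqX_trans _ _ _ (f2 n ^+ 3 * f2 n ^+ 3 * (f2 n ^+ 3 * f2 n ^+ 3))).
      by do 2!apply: eqX_mul; apply: eqX_sym.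
    rewrite (_ : _ * _ = f2 n ^+ 11 * f2 n); last by ring.
    by apply: eqX_mul => //; apply: eqX_pent.
  apply: eqX_trans; first exact: eqX_dissect eqJ4.
  rewrite dissect_Frobenius // dissect_pent ?mulr0 // => y e ye er.
  (* As 24 = 2 modulo 11, y^2 = 2 e + 1 = r + 1; for the five listed r this is a quadratic
     non-residue. *)
  have : (y ^ 2 %% 11 = (r + 1) %% 11)%N by rewrite ye; lia.
  have /allP check : all (fun c => all (fun r => c ^ 2 %% 11 != (r + 1) %% 11)
    [:: 1; 5; 6; 7; 9])%N (iota 0 11) by [].
  have /check/allP/(_ r Hr)/eqP : (y %% 11)%N \in iota 0 11 by rewrite mem_iota ltn_pmod.
  by rewrite modnXm.
have eq_h : eqX n.+1 h ((h * h) ^+ 11 * (J * J * (J * J) * (J * J * J))).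
  apply: (@eqX_trans _ _ _ (h * (f2 n * h) ^+ 21)).
    by rewrite -{1}[h]mulr1 -(expr1n _ 21); apply/eqX_mul/eqX_exp/eqX_sym => //.
  rewrite (_ : h * _ = (h * h) ^+ 11 * (f2 n ^+ 3 * f2 n ^+ 3 * (f2 n ^+ 3 * f2 n ^+ 3)
    * (f2 n ^+ 3 * f2 n ^+ 3 * f2 n ^+ 3))); last by ring.
  by do ?apply: eqX_mul.
apply: eqX_trans; first exact: eqX_dissect eq_h.
rewrite dissect_Frobenius // dissect_seventh //.
rewrite -[X in eqX _ _ X](mulr0 ((h * h) ^+ 11)); apply: eqX_mul => //.
have mul0 u v : eqX n.+1 v 0 -> eqX n.+1 (u * v) 0.
  by move=> v0; rewrite -[X in eqX _ _ X](mulr0 u); apply: eqX_mul.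
rewrite -[0](addr0 0) -{1}[0](addr0 0) -{1}[0](addr0 0) -{1}[0](addr0 0).
by do !apply: eqX_add; apply: mul0; apply: J4.
Qed.
End Ramanujan.

(** * Generating function *)

Section GeneratingFunction.
Variable R : comNzRingType.
Local Notation f2 n := (poch ('X^2 : {poly R}) 0 n).

Definition cpart_poly d n : {poly R} :=
  \prod_(c : cpart d n) \sum_(j < n.+1) 'X^(j * cpart_size c).

(** Expanding the product of sums indexes the monomials by multiplicity functions. *)
Lemma coef_cpart_poly d n : (cpart_poly d n)`_n = (a d n)%:R.
Proof.
rewrite /cpart_poly bigA_distr_bigA coef_sum.
under eq_bigr do rewrite prodrXr coefXn.
rewrite -natr_sum /a -sum1dep_card [in RHS]big_mkcond; congr _%:R.
by apply: eq_bigr => m _; rewrite eq_sym; case: eqP.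
Qed.

Lemma prod_ncolors d n :
  \prod_(k < n.*2) (1 - 'X^(k.+1) : {poly R}) ^+ ncolors d.+1 k.+1 =
  poch 'X 0 n.*2 * f2 n ^+ d.
Proof.
elim: n => [|n IHn]; first by rewrite big_ord0 !poch_nil expr1n mulr1.
rewrite doubleS !big_ord_recr /= IHn !pochS // /ncolors /= odd_double /= expr1.
rewrite -[in RHS]exprM mul2n doubleS exprMn.
move: (1 - 'X^(n.*2.+2)) (1 - 'X^(n.*2.+1)) (poch 'X^2 0 n ^+ d) => u v g.
by rewrite exprS; move: (u ^+ d) => w; ring.
Qed.

Lemma prod_ncolors_eqX d m n : (m <= n)%N ->
  eqX m.+1 (\prod_(k < n) (1 - 'X^(k.+1) : {poly R}) ^+ ncolors d k.+1)
           (\prod_(k < m) (1 - 'X^(k.+1)) ^+ ncolors d k.+1).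
Proof.
elim: n => [|n IHn]; first by rewrite leqn0 => /eqP ->.
rewrite leq_eqVlt => /predU1P[-> //|lt_mn]; rewrite big_ord_recr /=.
apply: eqX_trans (IHn lt_mn); rewrite -[X in eqX _ _ X]mulr1; apply: eqX_mul => //.
rewrite -[X in eqX _ _ X](expr1n _ (ncolors d n.+1)); apply: eqX_exp.
by rewrite -[X in eqX _ X _]mul1r; apply: eqX_1subXn.
Qed.

Lemma cpart_poly_inv d n :
  eqX n.+1 (cpart_poly d.+1 n * (poch 'X 0 n.*2 * f2 n ^+ d)) 1.
Proof.
rewrite -prod_ncolors.
apply: (@eqX_trans _ _ _ (cpart_poly d.+1 n *
  \prod_(k < n) (1 - 'X^(k.+1)) ^+ ncolors d.+1 k.+1)).
  by apply: eqX_mul => //; apply: prod_ncolors_eqX; lia.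
under eq_bigr do rewrite -[ncolors _ _]card_ord -prodr_const.
rewrite (@sig_big_dep _ _ _ _ (fun k : 'I_n => 'I_(ncolors d.+1 k.+1)) xpredT
  (fun _ => xpredT) (fun k _ => 1 - 'X^(k.+1))) /= -big_split /=.
apply: (@eqX_trans _ _ _ (\prod_(c : cpart d.+1 n) 1)); last by rewrite big1_eq.
apply: eqX_prod => c _; set s := cpart_size c.
have -> : (\sum_(j < n.+1) 'X^(j * s)) * (1 - 'X^s) = 1 * (1 - 'X^(s * n.+1)) :> {poly R}.
  under eq_bigr do rewrite mulnC exprM.
  by rewrite mul1r exprM mulrC -[in RHS]opprB subrX1 -mulNr opprB.
apply: eqX_1subXn; rewrite /s /cpart_size; nia.
Qed.

(** From f_1 psi = f_2^2 it follows that 1 / (f_1 f_2^d) = f_2 psi / f_2^(d+3). *)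
Lemma cpart_poly_theta d n (h : {poly R}) :
  eqX n.+1 (f2 n * h) 1 ->
  eqX n.+1 (cpart_poly d.+1 n) (h ^+ d.+3 * (pent_theta 'X^2 n * tri_theta 'X n)).
Proof.
move=> fh; set A := cpart_poly d.+1 n.
apply: (@eqX_trans _ _ _ (A * (f2 n * h) ^+ d.+3)).
  by rewrite -{1}[A]mulr1 -(expr1n _ d.+3); apply/eqX_mul/eqX_exp/eqX_sym.
apply: (@eqX_trans _ _ _ (h ^+ d.+3 * (f2 n * A * f2 n ^+ d * (poch 'X 0 n.*2 * tri_theta 'X n)))).
  rewrite (_ : A * _ = h ^+ d.+3 * (f2 n * A * f2 n ^+ d * f2 n ^+ 2)).
    by do 2!apply: eqX_mul => //; apply/eqX_sym/eqX_gauss.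
  by rewrite exprMn !exprS; ring.
apply: eqX_mul => //; rewrite (_ : _ * _ =
  (A * (poch 'X 0 n.*2 * f2 n ^+ d)) * (f2 n * tri_theta 'X n)); last by ring.
rewrite -[X in eqX _ _ X]mul1r; apply: eqX_mul; first exact: cpart_poly_inv.
by apply: eqX_mul => //; apply: eqX_pent.
Qed.
End GeneratingFunction.

(** * The sign-reversing involution *)

(** Modulo 12 the relation says z = 6 + y or 6 - y for p = 7, because x is odd, and z = 5 y or -5 y
    for p = 11. Each of these negates the symbol. *)
Lemma chi12_flip (R : comNzRingType) (p b x y z : nat) :
  (p = 7 /\ b = 2)%N \/ (p = 11 /\ b = 4)%N -> odd x ->
  [\/ p * z + 5 * y = 3 * b * x, p * z + 3 * b * x = 5 * y | p * z = 3 * b * x + 5 * y]%N ->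
  chi12 R z = - chi12 R y.
Proof.
move=> pb odd_x xyz.
have [i xi] : exists i, x = (2 * i + 1)%N by exists x./2; lia.
rewrite /chi12.
by case: pb => -[? ?]; subst; case: xyz => e;
  do 2![case: ifP => ?]; do 2?[case: ifP => ?]; rewrite ?opprK ?oppr0 //; lia.
Qed.

(* Multiplication by an element of norm p^2 in Q(sqrt -6), acting on the pairs (|y|, |x|):
   the sign of x is chosen so that the result is integral. *)
Definition flip (p b : nat) (v : nat * nat) : nat * nat :=
  let: (y, x) := v in
  if (p %| 5 * x + 2 * b * y)%N
  then ((3 * b * x - 5 * y + (5 * y - 3 * b * x)) %/ p, (5 * x + 2 * b * y) %/ p)%N
  else ((3 * b * x + 5 * y) %/ p, (5 * x - 2 * b * y + (2 * b * y - 5 * x)) %/ p)%N.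

Definition flips (n : nat) (f : nat * nat -> nat * nat) : Prop :=
  forall y x y' x' : nat, (3 * x ^ 2 + 2 * y ^ 2)%N = n -> odd x -> f (y, x) = (y', x') ->
  [/\ (3 * x' ^ 2 + 2 * y' ^ 2)%N = n, odd x', f (y', x') = (y, x) &
      forall R : comNzRingType, chi12 R y' = - chi12 R y].

(** The pair stands for 3 x + y sqrt(-6), of norm 3 (3 x^2 + 2 y^2), and the multiplier 5 + b
    sqrt(-6) or its conjugate has norm p^2. *)
Lemma flip_norm (p b x y x' y' : int) : p != 0 -> p ^+ 2 = 25 + 6 * b ^+ 2 ->
  p * x' = 5 * x + 2 * b * y \/ p * x' = - (5 * x + 2 * b * y) ->
  p * y' = 3 * b * x - 5 * y \/ p * y' = - (3 * b * x - 5 * y) ->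
  3 * x' ^+ 2 + 2 * y' ^+ 2 = 3 * x ^+ 2 + 2 * y ^+ 2.
Proof.
move=> p0 pb ex ey; apply: (@mulfI _ (p ^+ 2)); first exact: expf_neq0.
have -> : p ^+ 2 * (3 * x' ^+ 2 + 2 * y' ^+ 2) = 3 * (p * x') ^+ 2 + 2 * (p * y') ^+ 2 by ring.
by rewrite pb; case: ex => ->; case: ey => ->; ring.
Qed.

Ltac pb_lia pb := case: pb => -[? ?]; subst; lia.

Lemma flip_flips (p b n : nat) :
  (p = 7 /\ b = 2)%N \/ (p = 11 /\ b = 4)%N ->
  (p %| 24 * n + 5)%N -> ~~ (p ^ 2 %| 24 * n + 5)%N ->
  flips (24 * n + 5) (flip p b).
Proof.
move=> pb dvd_n ndvd_n y x y' x' xy odd_x; rewrite /flip.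
(* Only here does p^2 not dividing 24 n + 5 enter; it makes the choice of sign in [flip]
   unambiguous. *)
have coprime_p u v : (3 * u ^ 2 + 2 * v ^ 2)%N = (24 * n + 5)%N -> ~ (p %| u /\ p %| v)%N.
  move=> uv [/dvdnP[i ui] /dvdnP[j vj]]; case/negP: ndvd_n; rewrite -uv ui vj.
  by apply/dvdnP; exists (3 * i ^ 2 + 2 * j ^ 2)%N; lia.
(* Since 25 = p^2 - 6 b^2, the product (5 x + 2 b y)(5 x - 2 b y) is -2 b^2 (3 x^2 + 2 y^2) modulo
   p. The coefficient p - 2 b replaces -2 b to stay in [nat]. *)
have split_p : (p %| 5 * x + 2 * b * y)%N \/ (p %| 5 * x + (p - 2 * b) * y)%N.
  have check : all (fun c => all (fun d => (p %| 3 * c ^ 2 + 2 * d ^ 2) ==>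
      (p %| 5 * c + 2 * b * d) || (p %| 5 * c + (p - 2 * b) * d)) (iota 0 p))%N (iota 0 p).
    by case: pb => -[-> ->].
  have p_gt0 : (0 < p)%N by case: pb => -[-> _].
  have /allP/(_ (x %% p)%N) := check; rewrite mem_iota ltn_pmod // => /(_ isT).
  move=> /allP/(_ (y %% p)%N); rewrite mem_iota ltn_pmod // => /(_ isT).
  have red k l e : (p %| k * (x %% p) ^ e + l * (y %% p) ^ e)%N = (p %| k * x ^ e + l * y ^ e)%N.
    rewrite /dvdn -modnDm -[(k * _ %% p)%N]modnMmr -[(l * _ %% p)%N]modnMmr.
    by rewrite !modnXm !modnMmr modnDm.
  have := red 5%N (2 * b)%N 1%N; have := red 5%N (p - 2 * b)%N 1%N.
  by rewrite !expn1 => -> ->; rewrite red xy dvd_n => /orP.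
case: ifP => [dvd_p|ndvd_p] [ey ex].
  have e1 : (p * x' = 5 * x + 2 * b * y)%N by clear - pb dvd_p ex; pb_lia pb.
  (* The two truncated subtractions add up to an absolute value, whence the two cases. *)
  have e2 : (p * y' + 5 * y = 3 * b * x \/ p * y' + 3 * b * x = 5 * y)%N.
    by clear - pb dvd_p ey; pb_lia pb.
  have xy' : (3 * x' ^ 2 + 2 * y' ^ 2)%N = (24 * n + 5)%N.
    have E : 3 * x'%:Z ^+ 2 + 2 * y'%:Z ^+ 2 = 3 * x%:Z ^+ 2 + 2 * y%:Z ^+ 2.
      apply: (@flip_norm p b).
      - by case: pb => -[-> _].
      - by case: pb => -[-> ->].
      - by left; clear - e1; lia.
      - by clear - e2; case: e2 => e2; [left|right]; lia.
    by rewrite -xy; clear - E; lia.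
  split=> [||| R]; first exact: xy'.
  - by clear - pb e1 odd_x; pb_lia pb.
  - case: e2 => e2.
      rewrite ifT; last by clear - pb e1 e2; pb_lia pb.
      by congr pair; clear - pb e1 e2; pb_lia pb.
    (* The absolute value changed the sign of y', so the way back is the other branch. The first
       branch would make p divide both x' and y'. *)
    rewrite ifF; first by congr pair; clear - pb e1 e2; pb_lia pb.
    apply/negP => dvd'; apply: (coprime_p _ _ xy'); clear - pb e1 e2 dvd'.
    by split; pb_lia pb.
  - by apply: (chi12_flip _ pb odd_x); case: e2; [constructor 1|constructor 2].
have e1 : (p * y' = 3 * b * x + 5 * y)%N.
  by case: split_p => dvd_p; [rewrite dvd_p in ndvd_p|clear - pb dvd_p ey; pb_lia pb].
have e2 : (p * x' + 2 * b * y = 5 * x \/ p * x' + 5 * x = 2 * b * y)%N.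
  by case: split_p => dvd_p; [rewrite dvd_p in ndvd_p|clear - pb dvd_p ex; pb_lia pb].
have xy' : (3 * x' ^ 2 + 2 * y' ^ 2)%N = (24 * n + 5)%N.
  have E : 3 * x'%:Z ^+ 2 + 2 * y'%:Z ^+ 2 = 3 * x%:Z ^+ 2 + 2 * (- y%:Z) ^+ 2.
    apply: (@flip_norm p b).
    - by case: pb => -[-> _].
    - by case: pb => -[-> ->].
    - by clear - e2; case: e2 => e2; [left|right]; lia.
    - by left; clear - e1; lia.
  by rewrite -xy; clear - E; lia.
split=> [||| R]; first exact: xy'.
- by clear - pb e2 odd_x; pb_lia pb.
- case: e2 => e2.
    rewrite ifT; last by clear - pb e1 e2; pb_lia pb.
    by congr pair; clear - pb e1 e2; pb_lia pb.
  rewrite ifF; first by congr pair; clear - pb e1 e2; pb_lia pb.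
  apply/negP => dvd'; apply: (coprime_p _ _ xy'); clear - pb e1 e2 dvd'.
  by split; pb_lia pb.
- by apply: (chi12_flip _ pb odd_x); constructor 3.
Qed.

(** * Coefficients of f_2 psi(q) *)

Section ThetaCoefficients.
Variable R : comNzRingType.

Lemma chi12_polyC y : chi12 {poly R} y = (chi12 R y)%:P.
Proof. by rewrite /chi12; do 2?case: ifP => _; rewrite ?polyCN. Qed.

(** With y^2 = 24 e + 1 and x^2 = 8 t + 1, the exponent 2 e + t equals j exactly when 3 x^2 + 2 y^2
    = 24 j + 5. *)
Lemma coef_theta n j :
  (pent_theta 'X^2 n * tri_theta 'X n : {poly R})`_j =
  \sum_(v : 'I_(6 * n + 2) * 'I_(4 * n + 2) |
        odd v.2 && (3 * v.2 ^ 2 + 2 * v.1 ^ 2 == 24 * j + 5)%N) chi12 R v.1.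
Proof.
rewrite /pent_theta /tri_theta mulr_suml.
under eq_bigr do rewrite mulr_sumr.
rewrite pair_big /= coef_sum [LHS]big_mkcond [RHS]big_mkcond /=.
apply: eq_bigr => -[y x] _ /=; case: ifP => //= odd_x.
rewrite chi12_polyC -mulrA coefCM -exprM -exprD coefXn.
case: (eqVneq (chi12 R y) 0) => [chi0|chi_neq0].
  by rewrite chi0 mul0r; case: ifP.
have [e ye] := chi12_neq0 chi_neq0.
have [i xi] : exists i, nat_of_ord x = (2 * i + 1)%N by exists x./2; lia.
have xt := tri_double i.
have xe : (x ^ 2 = 8 * tri i + 1)%N by rewrite xi; lia.
rewrite ye xe !addnK !mulKn //.
have -> : (j == 2 * e + tri i)%N = (3 * (8 * tri i + 1) + 2 * (24 * e + 1) == 24 * j + 5)%N by lia.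
by case: ifP; rewrite ?mulr1 ?mulr0.
Qed.

Lemma theta_cancel n j f : (forall x : R, x = - x -> x = 0) -> (j <= n)%N ->
  flips (24 * j + 5) f -> (pent_theta 'X^2 n * tri_theta 'X n : {poly R})`_j = 0.
Proof.
move=> eq_opp0 le_jn ff; rewrite coef_theta; apply: eq_opp0.
pose P (v : 'I_(6 * n + 2) * 'I_(4 * n + 2)) :=
  odd v.2 && (3 * v.2 ^ 2 + 2 * v.1 ^ 2 == 24 * j + 5)%N.
rewrite -/(\sum_(v | P v) chi12 R v.1).
(* On solutions the defaults of [insubd] never occur: j <= n keeps the image inside the index
   ranges. *)
pose F v : 'I_(6 * n + 2) * 'I_(4 * n + 2) :=
  let w := f (nat_of_ord v.1, nat_of_ord v.2) in (insubd v.1 w.1, insubd v.2 w.2).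
have FP v : P v -> [/\ P (F v), F (F v) = v & chi12 R (F v).1 = - chi12 R v.1].
  case: v => y x /andP[/= odd_x /eqP xy].
  case Ef : (f (nat_of_ord y, nat_of_ord x)) => [y' x'].
  have [xy' odd_x' ff' chi'] := ff _ _ _ _ xy odd_x Ef.
  have lt_y : (y' < 6 * n + 2)%N.
    rewrite ltnNge; apply/negP => le_y; have := leq_mul le_y le_y.
    by clear - le_jn xy'; nia.
  have lt_x : (x' < 4 * n + 2)%N.
    rewrite ltnNge; apply/negP => le_x; have := leq_mul le_x le_x.
    by clear - le_jn xy'; nia.
  have EF : F (y, x) = (Ordinal lt_y, Ordinal lt_x).
    by rewrite /F Ef /=; congr pair; apply: val_inj; rewrite val_insubd /= ?lt_y ?lt_x.
  split; first by rewrite EF /P /= odd_x' xy' eqxx.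
    rewrite EF /F /= ff' /=; congr pair; apply: val_inj; rewrite val_insubd /=.
      by rewrite ltn_ord.
    by rewrite ltn_ord.
  by rewrite val_insubd lt_y chi'.
rewrite {1}(reindex_onto F F) => [|v /FP[]//].
rewrite -sumrN; apply: eq_big => [v|v].
  apply/andP/idP => [[PFv /eqP FFv]|/FP[-> -> _]//].
  by have [] := FP _ PFv; rewrite FFv.
case/andP=> [PFv /eqP FFv]; have [PFFv _ _] := FP _ PFv.
by rewrite FFv in PFFv; have [] := FP _ PFFv.
Qed.

End ThetaCoefficients.

(** * The congruences for [a] *)

Lemma Fp_eq_opp0 p (x : 'F_p) : prime p -> odd p -> x = - x -> x = 0.
Proof.
move=> p_pr odd_p /eqP; rewrite -addr_eq0 -mulr2n -mulr_natl mulf_eq0 => /orP[|/eqP//].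
rewrite -(dvdn_pcharf (pchar_Fp p_pr)) dvdn_prime2 // => /eqP p2.
by rewrite p2 in odd_p.
Qed.

(** The coefficient of h^p f_2 psi is a sum over exponents p k of h^p. For k = t modulo p the
    coefficient of h vanishes by Ramanujan; otherwise the complementary index is s modulo p but not
    modulo p^2, and the theta coefficient cancels. *)
Lemma a_congruence d p b s t n :
  p = d.+3 -> (p = 7 /\ b = 2)%N \/ (p = 11 /\ b = 4)%N ->
  (forall (m : nat) (h : {poly 'F_p}), eqX m.+1 (poch 'X^2 0 m * h) 1 ->
     eqX m.+1 (dissect p t h) 0) ->
  (forall j, j %% p = s %% p -> j %% p ^ 2 <> s ->
     p %| 24 * j + 5 /\ ~~ (p ^ 2 %| 24 * j + 5))%N ->
  (t < p)%N -> (s < p ^ 2)%N ->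
  (a d.+1 (p ^ 2 * n + (s + p * t)) = 0 %[mod p])%N.
Proof.
move=> pd pb ramanujan exceptional lt_tp lt_sp.
have p_pr : prime p by case: pb => -[-> _].
have odd_p : odd p by case: pb => -[-> _].
have charp := pchar_Fp p_pr.
set N := (p ^ 2 * n + (s + p * t))%N.
have [h fh] := @eqX_inv _ N.+1 (poch ('X^2 : {poly 'F_p}) 0 N) (poch_coef0 _ N).
have h0 := ramanujan _ _ fh.
apply/eqP; rewrite mod0n -/(dvdn _ _) (dvdn_pcharf charp) -coef_cpart_poly.
rewrite (cpart_poly_theta d fh) // -pd coefM; apply/eqP.
apply: big1 => -[i lt_iN] _ /=; rewrite coef_Frobenius //.
case: ifP => [/dvdnP[k ik]|]; last by rewrite mul0r.
have p_gt0 := prime_gt0 p_pr.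
rewrite {1}ik mulnK //.
have [kt|neq_kt] := eqVneq (k %% p)%N t.
  have lt_kN : (k < N.+1)%N by apply: leq_ltn_trans lt_iN; rewrite ik leq_pmulr.
  have := h0 _ lt_kN; rewrite coef_dissect kt eqxx coef0 => ->.
  by rewrite pd expr0n mul0r.
rewrite (@theta_cancel _ N _ (flip p b)) ?mulr0 ?leq_subr // => [x|].
  exact: Fp_eq_opp0.
have [dvd ndvd] : (p %| 24 * (N - i) + 5 /\ ~~ (p ^ 2 %| 24 * (N - i) + 5))%N.
  apply: exceptional; rewrite {}ik in lt_iN *; rewrite /N in lt_iN *;
    clear - pb lt_iN neq_kt lt_tp lt_sp; by case: pb => -[? ?]; subst; lia.
exact: flip_flips.
Qed.

Local Close Scope ring_scope.

Theorem theorem7p1 : forall n : nat,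
  a 5 (49 * n + 31) = 0 %[mod 7] /\ a 9 (121 * n + 36) = 0 %[mod 11].
Proof.
move=> n; split.
(* 24 * 10 + 5 = 5 * 7^2 and 31 = 10 + 7 * 3. *)
- apply: (@a_congruence 4 7 2 10 3) => //; first by left.
    by move=> m h; apply: ramanujan7; apply: pchar_Fp.
  by move=> j; lia.
(* 24 * 25 + 5 = 5 * 11^2 and 36 = 25 + 11 * 1. *)
- apply: (@a_congruence 8 11 4 25 1) => //; first by right.
    by move=> m h; apply: ramanujan11; apply: pchar_Fp.
  by move=> j; lia.
Qed.
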